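(* Let $n\ge 2$. Let $C$ be the ternary code of length $3^n$ with parity check matrix $H_{n,1}$. The number of distinct Steiner triple systems on $\{1,\dots,3^n\}$ of $3$-rank exactly $3^n-n$ whose blocks all have incidence vectors in $C$ is $$s'_=(n,1)=12^{3^{n-2}(3^{n-1}-1)/2}-\frac{6^{3^{n-1}}}{2\cdot 3^n}.$$
   Context: $H_{n,1}$ is the $n\times 3^n$ ternary matrix whose first row is the all-one vector and whose remaining $n-1$ rows form a matrix $B_{n,1}$ obtained by deleting one row from an $n\times 3^n$ matrix whose columns are all distinct vectors of $\mathrm{GF}(3)^n$ (so each vector of $\mathrm{GF}(3)^{n-1}$ occurs exactly $3$ times as a column of $B_{n,1}$). $C=\{c\in\mathrm{GF}(3)^{3^n}:H_{n,1}c^T=0\}$. A Steiner triple system on a set is a collection of $3$-subsets such that each $2$-subset lies in exactly one of them; ''distinct'' means distinct as block sets on the labeled point set. The $3$-rank is the rank over $\mathrm{GF}(3)$ of the block-by-point incidence matrix. *)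

(* Defs.v *)
From mathcomp Require Import all_boot all_order all_algebra.

Set Implicit Arguments.
Unset Strict Implicit.
Unset Printing Implicit Defensive.

Import GRing.Theory.
Local Open Scope ring_scope.

Definition steiner_triple_system (T : finType) (B : {set {set T}}) : bool :=
  [forall A in B, #|A| == 3%N] &&
  [forall P : {set T}, (#|P| == 2%N) ==> (#|[set A in B | P \subset A]| == 1%N)].

Definition incidence_vector (v : nat) (A : {set 'I_v}) : 'rV['F_3]_v :=
  \row_(j < v) (j \in A)%:R.

Definition incidence_matrix (v : nat) (B : {set {set 'I_v}}) :
    'M['F_3]_(#|B|, v) :=
  \matrix_(i < #|B|, j < v) (j \in enum_val i)%:R.

Definition rank3 (v : nat) (B : {set {set 'I_v}}) : nat :=
  \rank (incidence_matrix B).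

Definition ternary_code (m v : nat) (H : 'M['F_3]_(m, v)) : {set 'rV['F_3]_v} :=
  [set c | H *m c^T == 0].

(* H_{n,1}: an all-one row on top of B_{n,1}, which is M with row i deleted. *)
Definition parity_check (n v : nat) (M : 'M['F_3]_(n, v)) (i : 'I_n) :
    'M['F_3]_(1 + n.-1, v) :=
  col_mx (const_mx 1) (row' i M).

(* Main.v *)
(* Put V = GF(3)^(n-1). Mapping a point j to column j of B_{n,1} splits the points
   into fibers of size 3 over V; a triple has its incidence vector in C iff its
   image in V sums to zero, so the image is either one point or a line of V.
   A Steiner triple system with blocks in C therefore consists of all the fibers
   and, over each of the 3^(n-2) (3^(n-1) - 1) / 2 lines, one of the 12 Latin
   squares of order 3; over GF(3) those are all of the form z = s x + t y + c with
   s, t = 1 or -1, which makes the choices explicit.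

   The rank is less than 3^n - n iff the dual code of the system contains a
   function f that is not an affine function of the image in V. A dual function
   is either constant on all fibers, hence affine, or injective on all fibers. In
   the latter case the system consists of the triples on which both f and the
   projection to V sum to zero. There are 6^(3^(n-1)) functions f that are
   injective on every fiber, and two of them, f and f', define the same system
   iff f' - f or f' + f is affine, so each such system arises 2 * 3^n times. *)

Require Import Defs.
From mathcomp Require Import all_boot all_order all_algebra.
From mathcomp Require Import perm ring zify.

Set Implicit Arguments.
Unset Strict Implicit.
Unset Printing Implicit Defensive.

Import GRing.Theory.
Local Open Scope ring_scope.

(** * Arithmetic of GF(3) and Latin squares of order 3 *)

Lemma F3P (P : 'F_3 -> Prop) : P 0 -> P 1 -> P (-1) -> forall a, P a.
Proof.
move=> P0 P1 P2 [[|[|[|//]]] lta]; [move: P0|move: P1|move: P2];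
  by congr (P _); apply: val_inj.
Qed.

Lemma F3_sum0 (a b c : 'F_3) : a != b -> (a + b + c == 0) = (c != a) && (c != b).
Proof. by move: a b c; do 3!elim/F3P. Qed.

Lemma F3_sum0_eq (a c : 'F_3) : (a + a + c == 0) = (c == a).
Proof. by move: a c; do 2!elim/F3P. Qed.

Lemma F3_sign (a : 'F_3) : a != 0 -> exists s : bool, a = (-1) ^+ s.
Proof. by move: a; elim/F3P=> // _; [exists false | exists true]. Qed.

(** Each row and column is a permutation of GF(3), so it sums to zero and [L] is determined by its
    values on 0 and 1. The differences from [L 0 0] to [L 1 0] and [L 0 1] give the two signs, and
    [L 1 1] is then forced. *)
Lemma F3_latin (L : 'F_3 -> 'F_3 -> 'F_3) :
    (forall a, injective (L a)) -> (forall b, injective (L^~ b)) ->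
  exists k : bool * bool * 'F_3,
    forall a b, (-1) ^+ k.1.1 * a + k.2 + (-1) ^+ k.1.2 * b + L a b = 0.
Proof.
move=> Lr Lc.
have sum0 (f : 'F_3 -> 'F_3) : injective f -> f (-1) = - (f 0 + f 1).
  move=> f_inj; apply/eqP; rewrite -addr_eq0 addrC F3_sum0 ?inj_eq //.
have row a : L a (-1) = - (L a 0 + L a 1) by exact: sum0.
have col b : L (-1) b = - (L 0 b + L 1 b) by exact: (sum0 (L^~ b)).
have [s Ds] : exists s : bool, L 0 0 - L 1 0 = (-1) ^+ s.
  by apply: F3_sign; rewrite subr_eq0 (inj_eq (Lc _)).
have [t Dt] : exists t : bool, L 0 0 - L 0 1 = (-1) ^+ t.
  by apply: F3_sign; rewrite subr_eq0 (inj_eq (Lr _)).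
have L10 : L 1 0 = L 0 0 - (-1) ^+ s by rewrite -Ds subKr.
have L01 : L 0 1 = L 0 0 - (-1) ^+ t by rewrite -Dt subKr.
have L11 : L 1 1 = L 0 0 - (-1) ^+ s - (-1) ^+ t.
  (* If the signs differ, row 1 and column 1 leave one value for [L 1 1]. If they agree, row -1 and
     column -1 also exclude [L 0 0]. *)
  apply/eqP; have := inj_eq (Lr 1) 0 1; have := inj_eq (Lc 1) 0 1.
  have := inj_eq (Lr (-1)) 0 1; have := inj_eq (Lc (-1)) 0 1.
  rewrite /= !row !col L10 L01.
  move: (L 0 0) (L 1 1) {L10 L01 Ds Dt}.
  by case: s; case: t; do 2!elim/F3P.
exists (s, t, - L 0 0).
elim/F3P; elim/F3P; rewrite /= ?row ?col ?L11 ?L10 ?L01;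
  apply/eqP; move: (L 0 0) {Ds Dt L10 L01 L11}; by case: s; case: t; elim/F3P.
Qed.

Lemma F3_sign_inj : injective (fun s : bool => (-1) ^+ s : 'F_3).
Proof. by case=> -[] // /eqP. Qed.

Lemma F3_latin_inj (k k' : bool * bool * 'F_3) :
    (forall a b, (-1) ^+ k.1.1 * a + k.2 + (-1) ^+ k.1.2 * b =
                 (-1) ^+ k'.1.1 * a + k'.2 + (-1) ^+ k'.1.2 * b :> 'F_3) ->
  k = k'.
Proof.
case: k k' => [[s t] c] [[s' t'] c'] /= E.
have := E 0 0; rewrite !mulr0 !add0r !addr0 => Dc; rewrite -{c'}Dc in E *.
have := E 1 0; rewrite !mulr0 !addr0 !mulr1 => /addIr/F3_sign_inj <-.
by have := E 0 1; rewrite !mulr0 !add0r !mulr1 => /addrI/F3_sign_inj <-.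
Qed.

(** * Steiner triple systems described by the third point of a pair *)

Section Triples.
Variable T : finType.
Implicit Types (x y z t : T) (A : {set T}) (B : {set {set T}}).

Lemma sum_set3 (V : nmodType) (F : T -> V) x y z : x != y -> z != x -> z != y ->
  \sum_(i in [set x; y; z]) F i = F x + F y + F z.
Proof.
move=> xy zx zy; rewrite setUC big_setU1 ?inE ?negb_or ?zx //=.
by rewrite big_setU1 ?inE //= big_set1 addrC.
Qed.

Lemma cards3 x y z : x != y -> z != x -> z != y -> #|[set x; y; z]| = 3%N.
Proof.
by move=> xy zx zy; rewrite setUC cardsU1 !inE (negPf zx) (negPf zy) cards2 xy.
Qed.

Lemma cards3_pair A x y : #|A| = 3%N -> x \in A -> y \in A -> x != y ->
  exists z, [/\ z != x, z != y & A = [set x; y; z]].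
Proof.
move=> A3 Ax Ay xy.
have sxyA : [set x; y] \subset A by rewrite subUset !sub1set Ax.
have /cards1P[z Dz] : #|A :\: [set x; y]| == 1%N.
  by rewrite cardsDS // A3 cards2 xy.
have : z \in A :\: [set x; y] by rewrite Dz set11.
rewrite !inE negb_or -andbA => /and3P[zx zy Az]; exists z; split=> //.
by rewrite -Dz setUC setDE setUIl [~: _ :|: _]setUC setUCr setIT; apply/esym/setUidPl.
Qed.

Lemma sts_intro B : (forall A, A \in B -> #|A| = 3%N) ->
    (forall x y, x != y -> exists t, [/\ t != x, t != y &
       forall z, z != x -> z != y -> ([set x; y; z] \in B) = (z == t)]) ->
  steiner_triple_system B.
Proof.
move=> B3 BT; apply/andP; split; first by apply/forall_inP=> A /B3->.
apply/forallP=> P; apply/implyP=> /cards2P[x [y [xy ->]]].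
have [t [tx ty Dt]] := BT x y xy.
apply/cards1P; exists [set x; y; t]; apply/setP=> A; rewrite !inE.
apply/andP/eqP=> [[BA]|->]; last by rewrite Dt // eqxx subsetUl.
rewrite subUset !sub1set => /andP[Ax Ay].
have [z [zx zy DA]] := cards3_pair (B3 _ BA) Ax Ay xy.
by move: BA; rewrite DA Dt // => /eqP->.
Qed.

Lemma sts_card3 B A : steiner_triple_system B -> A \in B -> #|A| = 3%N.
Proof. by case/andP=> /forall_inP B3 _ /B3/eqP. Qed.

Lemma sts_pair B x y : steiner_triple_system B -> x != y ->
  exists2 A, [/\ A \in B, x \in A & y \in A] &
    forall A', A' \in B -> x \in A' -> y \in A' -> A' = A.
Proof.
case/andP=> _ /forallP/(_ [set x; y])/implyP BP xy.
have /cards1P[A DA] := BP (introT eqP (etrans (cards2 x y) (congr1 _ (congr1 _ xy)))).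
exists A => [|A' BA' Ax Ay].
  have : A \in [set A] by rewrite set11.
  by rewrite -DA inE subUset !sub1set => /and3P.
by apply/set1P; rewrite -DA inE BA' subUset !sub1set Ax.
Qed.

Lemma sts_uniq B A A' x y : steiner_triple_system B -> x != y ->
  A \in B -> A' \in B -> x \in A -> y \in A -> x \in A' -> y \in A' -> A = A'.
Proof.
move=> sB xy BA BA' Ax Ay A'x A'y; have [A0 _ uA0] := sts_pair sB xy.
by rewrite (uA0 A) // (uA0 A').
Qed.

Lemma sts_third B x y : steiner_triple_system B -> x != y ->
  exists t, [/\ t != x, t != y &
       forall z, z != x -> z != y -> ([set x; y; z] \in B) = (z == t)].
Proof.
move=> stsB xy; have [A [BA Ax Ay] uA] := sts_pair stsB xy.
have [t [tx ty DA]] := cards3_pair (sts_card3 stsB BA) Ax Ay xy.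
exists t; split=> // z zx zy; apply/idP/eqP=> [Bz|->]; last by rewrite -DA.
have : z \in A by rewrite -(uA _ Bz) !inE eqxx ?orbT.
by rewrite DA !inE (negPf zx) (negPf zy) => /eqP.
Qed.

(** Two points of a block of [B'] lie in a block of [B], which is also in [B'] and therefore is the
    given block. *)
Lemma sts_sub_eq B B' : steiner_triple_system B -> steiner_triple_system B' ->
  B \subset B' -> B = B'.
Proof.
move=> sB sB' /subsetP sBB'; apply/eqP; rewrite eqEsubset; apply/andP.
split; apply/subsetP => // A BA.
have /card_gt1P[x [y [Ax Ay xy]]] : (1 < #|A|)%N by rewrite (sts_card3 sB' BA).
have [A0 [BA0 A0x A0y] _] := sts_pair sB xy.
have [A1 _ uA1] := sts_pair sB' xy.
by rewrite (uA1 A) // -(uA1 A0) //; apply: sBB'.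
Qed.

(** Double counting of incident pairs [P], [A]: every 2-subset lies in one block, and every block
    contains three 2-subsets. *)
Lemma sts_card B : steiner_triple_system B -> 'C(#|T|, 2) = (3 * #|B|)%N.
Proof.
move=> sB; rewrite -card_draws -sum1_card.
transitivity (\sum_(P : {set T} | #|P| == 2%N) \sum_(A in B | P \subset A) 1)%N.
  apply: eq_big => [P|P]; rewrite ?inE // => P2.
  case/andP: sB => _ /forallP/(_ P); rewrite P2 /= => /eqP P1.
  by rewrite -[LHS]P1 -sum1_card; apply: eq_bigl => A; rewrite inE.
rewrite (exchange_big_dep (mem B)) /=; last by move=> P A _ /andP[].
rewrite mulnC -sum_nat_const; apply: eq_bigr => A BA.
have <- : 'C(#|A|, 2) = 3%N by rewrite (sts_card3 sB BA).
rewrite -cards_draws -sum1dep_card.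
by apply: eq_bigl => P; rewrite BA andbC.
Qed.

End Triples.

Lemma third_eq (V : zmodType) (u v w : V) : (u + v + w == 0) = (w == - (u + v)).
Proof. by rewrite addrC addr_eq0. Qed.

(** * Lines of an elementary abelian 3-group *)

Section ElementaryGroup.
Variables (V : finZmodType) (V3 : forall u : V, u *+ 3 = 0).

(** These are the lines of [V] as an affine space over GF(3): distinct points with zero sum have the
    form u, u + d, u + 2d. *)
Definition affine_triples : {set {set V}} :=
  [set l : {set V} | (#|l| == 3%N) && (\sum_(u in l) u == 0)].

Lemma third_neq (u v : V) : (- (u + v) == u) = (u == v).
Proof.
by rewrite eq_sym -addr_eq0 addrA -mulr2n -(inj_eq (addrI u)) addrA -mulrS V3 addr0 add0r eq_sym.
Qed.

Lemma affine_triples_sts : steiner_triple_system affine_triples.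
Proof.
apply: sts_intro => [A|u v uv]; first by rewrite inE => /andP[/eqP].
exists (- (u + v)); split=> [||w wu wv]; first by rewrite third_neq.
  by rewrite addrC third_neq eq_sym.
by rewrite inE cards3 // sum_set3 // third_eq.
Qed.

(** * Systems on a point set with coordinates in [V] times GF(3) *)

Section LocalSystem.
Variables (T : finType) (pi : T -> V) (h : T -> 'F_3) (pt : V -> 'F_3 -> T).
Hypotheses (pi_pt : forall u a, pi (pt u a) = u) (h_pt : forall u a, h (pt u a) = a).
Hypothesis (ptK : forall x, pt (pi x) (h x) = x).

Lemma pt_neq u v a b : u != v -> pt u a != pt v b.
Proof. by apply: contraNneq => /(congr1 pi); rewrite !pi_pt => ->. Qed.

Lemma pt_inj u : injective (pt u).
Proof. by move=> a b /(congr1 h); rewrite !h_pt. Qed.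

Definition fiberwise_inj (f : T -> 'F_3) := forall x y, pi x = pi y -> f x = f y -> x = y.

(** Indexing [F] by the image of the triple lets each line carry its own equation; a constant family
    [F] gives one global equation. *)
Definition local_system (F : {set V} -> T -> 'F_3) : {set {set T}} :=
  [set A : {set T} | [&& #|A| == 3%N, \sum_(x in A) pi x == 0
                       & \sum_(x in A) F (pi @: A) x == 0]].

Lemma fiberwise_inj_surj f : fiberwise_inj f -> forall u a, exists2 x, pi x = u & f x = a.
Proof.
move=> f_inj u a.
have inj : injective (fun b => f (pt u b)).
  by move=> b b' /f_inj; rewrite !pi_pt => /(_ erefl)/pt_inj.
by exists (pt u (invF inj a)) => //; apply: (f_invF inj).
Qed.

Lemma fiber_pair u : exists x y, [/\ pi x = u, pi y = u & x != y].
Proof.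
exists (pt u 0), (pt u 1); rewrite !pi_pt; split=> //.
by apply/eqP=> /(congr1 h); rewrite !h_pt => /eqP.
Qed.

Lemma fiberwise_inj_sum f x y z : fiberwise_inj f -> pi x = pi y -> pi z = pi y ->
  x != y -> z != x -> z != y -> f x + f y + f z = 0.
Proof.
move=> f_inj pxy pzy xy zx zy; apply/eqP; rewrite F3_sum0.
  by apply/andP; split; [apply: contraNneq zx | apply: contraNneq zy] => /f_inj-> //; rewrite pzy.
by apply: contraNneq xy => /f_inj->.
Qed.

Lemma local_system_sts F : (forall l, fiberwise_inj (F l)) ->
  steiner_triple_system (local_system F).
Proof.
move=> F_inj; apply: sts_intro => [A|x y xy]; first by rewrite inE => /and3P[/eqP].
(* The image of the block through [x] and [y] is known before its third point, so the function [F l]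
   to be solved is fixed. It is bijective on the fiber over the third image point, which gives a
   unique [t]. *)
pose l := [set pi x; pi y; - (pi x + pi y)].
have [t Dpt Dft] := fiberwise_inj_surj (F_inj l) (- (pi x + pi y)) (- (F l x + F l y)).
have tx : t != x.
  apply: contraNneq xy => tx; rewrite tx in Dpt Dft.
  have /eqP := esym Dpt; rewrite third_neq => /eqP pxy.
  apply/eqP/(F_inj l) => //; apply/eqP.
  by rewrite eq_sym -F3_sum0_eq -addrA {1}Dft addNr.
have ty : t != y.
  apply: contraNneq xy => ty; rewrite ty in Dpt Dft.
  have /eqP := esym Dpt; rewrite addrC third_neq => /eqP pxy.
  apply/eqP/(F_inj l) => //; apply/eqP; rewrite -F3_sum0_eq.
  by rewrite -addrA [F l y + F l x]addrC {1}Dft addNr.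
exists t; split=> // z zx zy; rewrite inE cards3 // !sum_set3 // eqxx !third_eq /=.
have Dl s : pi s = - (pi x + pi y) -> pi @: [set x; y; s] = l.
  by move=> ps; rewrite !imsetU !imset_set1 ps.
apply/andP/eqP=> [[/eqP pz]|->]; last by rewrite Dl Dpt // Dft.
by rewrite Dl // => /eqP fz; apply: (F_inj l); rewrite ?pz ?fz.
Qed.

Definition projects_to_lines (B : {set {set T}}) :=
  [forall A in B, \sum_(x in A) pi x == 0].

Lemma local_system_projects F : projects_to_lines (local_system F).
Proof. by apply/forall_inP=> A; rewrite inE => /and3P[]. Qed.

Lemma projects_third B x y : steiner_triple_system B -> projects_to_lines B -> x != y ->
  exists t, [/\ t != x, t != y, pi t = - (pi x + pi y) & [set x; y; t] \in B].
Proof.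
move=> sB /forall_inP pB xy; have [t [tx ty Dt]] := sts_third sB xy.
have Bt : [set x; y; t] \in B by rewrite Dt.
by exists t; split=> //; apply/eqP; rewrite -third_eq; move/pB: Bt; rewrite sum_set3.
Qed.

Lemma affine_tripleP l : l \in affine_triples -> exists u v,
  [/\ u != v, enum l = [:: u; v; - (u + v)], l = [set u; v; - (u + v)],
      - (u + v) != u & - (u + v) != v].
Proof.
rewrite inE cardE => /andP[]; have := enum_uniq l.
have Dl : l =i enum l by move=> x; rewrite mem_enum.
case: (enum l) Dl => [|u [|v [|w [|]]]] //= Dl; rewrite !inE !negb_or -!andbA.
case/and4P=> uv uw vw _ _; have -> : l = [set u; v; w].
  by apply/setP=> x; rewrite Dl !inE orbA.
rewrite sum_set3 //; try by rewrite eq_sym.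
by rewrite third_eq => /eqP Dw; exists u, v; rewrite -Dw; split=> //; rewrite eq_sym.
Qed.

(* A Latin square of order 3 on the fibers over the line [{u, v, w}] is given by
   an equation [s a + c + t b + d = 0] with signs [s], [t] and a constant [c]. *)
Definition line_coord (l : {set V}) (k : bool * bool * 'F_3) (x : T) : 'F_3 :=
  if pi x == nth 0 (enum l) 0 then (-1) ^+ k.1.1 * h x + k.2
  else if pi x == nth 0 (enum l) 1 then (-1) ^+ k.1.2 * h x else h x.

(** On a single fiber the formula is a sign times [h] plus a constant. This covers every set [l],
    also those with fewer than two points, where [nth] returns its default. *)
Lemma line_coord_inj l k : fiberwise_inj (line_coord l k).
Proof.
move=> x y pxy; rewrite /line_coord pxy => hxy; rewrite -[x]ptK -[y]ptK pxy.
congr (pt _ _); move: hxy; have sI (s : bool) := mulrI (GRing.unitrX s (GRing.unitrN1 'F_3)).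
by case: ifP => _ => [/addIr/sI //|]; case: ifP => _ => [/sI|].
Qed.

Lemma sum_line_coord u v k a b c :
    enum [set u; v; - (u + v)] = [:: u; v; - (u + v)] -> u != v ->
    - (u + v) != u -> - (u + v) != v ->
  \sum_(x in [set pt u a; pt v b; pt (- (u + v)) c])
     line_coord [set u; v; - (u + v)] k x =
   (-1) ^+ k.1.1 * a + k.2 + (-1) ^+ k.1.2 * b + c.
Proof.
move=> El uv wu wv.
rewrite sum_set3 ?pt_neq // /line_coord El /= !pi_pt !h_pt !eqxx.
by rewrite [v == u]eq_sym (negPf uv) (negPf wu) (negPf wv).
Qed.

Lemma projects_line_coord B l : steiner_triple_system B -> projects_to_lines B ->
  l \in affine_triples ->
  exists k, forall A, A \in B -> pi @: A = l -> \sum_(x in A) line_coord l k x = 0.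
Proof.
move=> sB pB /affine_tripleP[u [v [uv El Dl wu wv]]]; set w := - (u + v) in El Dl wu wv.
(* Points over [u] and [v] span a block whose third point lies over [w]; its coordinate is the entry
   of the Latin square. *)
have /fin_all_exists[L BL] (p : 'F_3 * 'F_3) :
    exists c, [set pt u p.1; pt v p.2; pt w c] \in B.
  have [t [_ _ pt_t Bt]] := projects_third sB pB (pt_neq p.1 p.2 uv).
  by exists (h t); move: pt_t; rewrite !pi_pt -/w => <-; rewrite ptK.
pose L2 a b := L (a, b).
have BL2 a b : [set pt u a; pt v b; pt w (L2 a b)] \in B by apply: (BL (a, b)).
have [a b b' | b a a' | k Lk] := @F3_latin L2.
(* Equal entries in a row give two blocks sharing their points over [u] and [w]. They coincide, so
   their points over [v] agree as well. Columns are treated in the same way. *)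
- move=> DL; apply: (@pt_inj v).
  have : pt v b \in [set pt u a; pt v b'; pt w (L2 a b')].
    rewrite (_ : [set _; _; _] = [set pt u a; pt v b; pt w (L2 a b)]) ?inE ?eqxx ?orbT //.
    apply: (@sts_uniq _ B _ _ (pt u a) (pt w (L2 a b)));
      rewrite ?BL2 ?pt_neq ?inE ?DL ?eqxx ?orbT //.
    by rewrite eq_sym.
  rewrite !inE -orbA => /or3P[] /eqP // /(congr1 pi) /eqP; rewrite !pi_pt.
    by rewrite eq_sym (negPf uv).
  by rewrite eq_sym (negPf wv).
- move=> /= DL; apply: (@pt_inj u).
  have : pt u a \in [set pt u a'; pt v b; pt w (L2 a' b)].
    rewrite (_ : [set _; _; _] = [set pt u a; pt v b; pt w (L2 a b)]) ?inE ?eqxx ?orbT //.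
    apply: (@sts_uniq _ B _ _ (pt v b) (pt w (L2 a b)));
      rewrite ?BL2 ?pt_neq ?inE ?DL ?eqxx ?orbT //.
    by rewrite eq_sym.
  rewrite !inE -orbA => /or3P[] /eqP // /(congr1 pi) /eqP; rewrite !pi_pt.
    by rewrite (negPf uv).
  by rewrite eq_sym (negPf wu).
exists k => A BA pA.
have /imsetP[x Ax Du] : u \in pi @: A by rewrite pA Dl !inE eqxx.
have /imsetP[y Ay Dv] : v \in pi @: A by rewrite pA Dl !inE eqxx orbT.
have -> : A = [set pt u (h x); pt v (h y); pt w (L2 (h x) (h y))].
  apply: (@sts_uniq _ B _ _ x y) => //; rewrite ?Du ?Dv ?ptK ?inE ?eqxx ?orbT //.
  by apply: contraNneq uv => xy; rewrite Du Dv xy.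
by rewrite Dl sum_line_coord -?Dl ?Lk.
Qed.

(** * One Latin square per line: counting the systems with blocks in the code *)

Definition line_choice := {ffun {l | l \in affine_triples} -> bool * bool * 'F_3}.

(** The default triple serves blocks whose image is a single point: a fiber satisfies the equation
    of any fiberwise injective function. *)
Definition choice_system (phi : line_choice) :=
  local_system (fun l => line_coord l (oapp phi (false, false, 0) (insub l))).

Lemma choice_system_inj : injective choice_system.
Proof.
move=> phi phi' eq_sys; apply/ffunP=> -[l Ll].
have [u [v [uv El Dl wu wv]]] := affine_tripleP Ll.
have mem psi a b c : ([set pt u a; pt v b; pt (- (u + v)) c] \in choice_system psi) =
    let k := psi (Sub l Ll) in
    ((-1) ^+ k.1.1 * a + k.2 + (-1) ^+ k.1.2 * b + c == 0).
  rewrite inE cards3 ?pt_neq //= sum_set3 ?pt_neq // !pi_pt subrr eqxx /=.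
  by rewrite !imsetU !imset_set1 !pi_pt -Dl insubT /= {1}Dl sum_line_coord -?Dl.
apply: F3_latin_inj => a b.
set X := (X in X = _); set Y := (Y in _ = Y).
(* The third coordinate [- X] solves the equation of [phi]; the triple is then in both systems, so
   it solves that of [phi'] too and the two forms agree at [a], [b]. *)
have /= := mem phi' a b (- X); rewrite -eq_sys mem /= subrr eqxx.
by move/esym/eqP; rewrite addrC => /eqP; rewrite addr_eq0 => /eqP/oppr_inj.
Qed.

Lemma line_choice_exists B : steiner_triple_system B -> projects_to_lines B ->
  exists phi, B = choice_system phi.
Proof.
move=> sB pB.
have /fin_all_exists[k Dk] (l : {l | l \in affine_triples}) :
    exists k, forall A, A \in B -> pi @: A = val l -> \sum_(x in A) line_coord (val l) k x = 0.
  exact: projects_line_coord (valP l).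
exists (finfun k); apply: sts_sub_eq => //.
  by apply: local_system_sts => l; apply: line_coord_inj.
apply/subsetP=> A BA; have pA := forall_inP pB _ BA.
have A3 := sts_card3 sB BA; rewrite inE A3 pA eqxx /=.
have [l _ eq_l|not_line] := insubP; first by rewrite /= ffunE -eq_l Dk.
have /card_gt1P[x [y [Ax Ay xy]]] : (1 < #|A|)%N by rewrite A3.
have [z [zx zy DA]] := cards3_pair A3 Ax Ay xy.
move: pA; rewrite DA !sum_set3 // third_eq => /eqP pz.
(* Otherwise the image of [A] would be a line. Hence [A] is a whole fiber, on which the coordinate
   sums to zero. *)
have pxy : pi x = pi y.
  apply: contraNeq not_line => pxy; rewrite DA !imsetU !imset_set1 pz inE.
  have wx : - (pi x + pi y) != pi x by rewrite third_neq.
  have wy : - (pi x + pi y) != pi y by rewrite addrC third_neq eq_sym.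
  by rewrite cards3 // sum_set3 // third_eq !eqxx.
rewrite (fiberwise_inj_sum (@line_coord_inj _ _)) // pz pxy.
by apply/eqP; rewrite third_neq.
Qed.

Lemma card_projecting_sts :
  #|[set B | steiner_triple_system B && projects_to_lines B]| = (12 ^ #|affine_triples|)%N.
Proof.
rewrite (_ : [set B | _] = choice_system @: setT).
  rewrite card_imset; last exact: choice_system_inj.
  (* 12 = 2 * 2 * 3: two signs and a constant for each line. *)
  rewrite cardsT card_ffun card_sig !card_prod !card_bool card_Fp //.
apply/setP=> B; rewrite inE; apply/andP/imsetP=> [[sB pB]|[phi _ ->]].
  by have [phi] := line_choice_exists sB pB; exists phi.
by rewrite local_system_projects local_system_sts // => l; apply: line_coord_inj.
Qed.

(** * Functions orthogonal to all blocks *)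

Definition dual_fun (B : {set {set T}}) (f : T -> 'F_3) := [forall A in B, \sum_(x in A) f x == 0].

Lemma dual_third B f x y : steiner_triple_system B -> projects_to_lines B -> dual_fun B f ->
  x != y -> exists t, [/\ t != x, t != y, pi t = - (pi x + pi y) & f t = - (f x + f y)].
Proof.
move=> sB pB /forall_inP dB xy; have [t [tx ty pt_t Bt]] := projects_third sB pB xy.
by exists t; split=> //; apply/eqP; rewrite -third_eq; move/dB: Bt; rewrite sum_set3.
Qed.

Lemma fiber_third x y z t : pi y = pi x -> pi z = pi x -> pi t = pi x ->
  x != y -> z != x -> z != y -> t != x -> t != y -> z = t.
Proof.
have hI s : pi s = pi x -> forall s', pi s' = pi x -> (h s == h s') = (s == s').
  by move=> ps s' ps'; apply/eqP/eqP=> [hs|->//]; rewrite -[s]ptK -[s']ptK hs ps ps'.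
move=> py pz pt_t xy zx zy tx ty; apply/eqP; rewrite -hI //.
have hxy : h x != h y by rewrite hI.
have : h x + h y + h z == 0 by rewrite F3_sum0 // !hI // zx.
by rewrite third_eq => /eqP->; rewrite eq_sym -third_eq F3_sum0 // !hI // tx.
Qed.

(** A coincidence on one fiber makes [f] constant there, because the third point of that fiber
    completes a block. Blocks through that fiber then carry the constancy to every other fiber. *)
Lemma dual_fiber_const B f : steiner_triple_system B -> projects_to_lines B -> dual_fun B f ->
    (exists x y, [/\ x != y, pi x = pi y & f x = f y]) ->
  forall x y, pi x = pi y -> f x = f y.
Proof.
move=> sB pB dB [x [y [xy pxy fxy]]].
have [t [tx ty pt_t ft]] := dual_third sB pB dB xy.
have {}pt_t : pi t = pi x by apply/eqP; rewrite pt_t third_neq pxy.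
have {}ft : f t = f x by apply/eqP; rewrite ft -fxy eq_sym -third_eq F3_sum0_eq.
have const_x z : pi z = pi x -> f z = f x.
  move=> pz; have [-> //|zx] := eqVneq z x; have [-> //|zy] := eqVneq z y.
  by rewrite (@fiber_third x y z t).
move=> z z' pzz'; have [->//|zz'] := eqVneq z z'.
have [pz|pz] := eqVneq (pi z) (pi x); first by rewrite !const_x // -pzz'.
have xz : x != z by apply: contraNneq pz => ->.
have [s [sx sz ps fs]] := dual_third sB pB dB xz.
have z's : z' != s.
  apply: contraNneq pz => z's; move/eqP: ps.
  by rewrite -z's -pzz' [_ == - _]eq_sym addrC third_neq.
(* The block through [x], [z], [s] followed by the block through [z'], [s] leads back to the fiber
   of [x]. There [f] is constant, and comparing the two block sums gives [f z = f z']. *)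
have [r [_ _ pr fr]] := dual_third sB pB dB z's.
have /const_x fr' : pi r = pi x by rewrite pr ps -pzz' opprD opprK addrC addrK.
move: fr; rewrite fr' fs opprD opprK addrCA => /eqP.
by rewrite eq_sym -subr_eq0 addrAC subrr add0r addrC subr_eq0 => /eqP.
Qed.

Lemma dual_fiber_factor B f : steiner_triple_system B -> projects_to_lines B -> dual_fun B f ->
    (forall x y, pi x = pi y -> f x = f y) ->
  exists2 g : V -> 'F_3, forall x, f x = g (pi x) & forall u v, g u + g v + g (- (u + v)) = 0.
Proof.
move=> sB pB dB f_const; exists (fun u => f (pt u 0)) => [x|u v].
  by apply: f_const; rewrite pi_pt.
(* Heights 0 and 1 keep the two points distinct even when [u = v], so the relation for [g] holds for
   all pairs. *)
have [|pt_t] := altP (pt u 0 =P pt v 1).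
  by move/(congr1 h); rewrite !h_pt => /eqP.
have [t [_ _ pt_r ft]] := dual_third sB pB dB pt_t.
rewrite (f_const (pt v 0) (pt v 1)) ?pi_pt // (f_const (pt (- (u + v)) 0) t).
  by rewrite ft subrr.
by rewrite pt_r !pi_pt.
Qed.

(** * Functions injective on every fiber and the systems they define *)

Definition fiberwise_inj_funs : {set {ffun T -> 'F_3}} :=
  [set f : {ffun T -> 'F_3} | [forall x, forall y, (pi x == pi y) && (f x == f y) ==> (x == y)]].

Lemma fiberwise_injP (f : {ffun T -> 'F_3}) : reflect (fiberwise_inj f) (f \in fiberwise_inj_funs).
Proof.
rewrite inE; apply: (iffP 'forall_'forall_implyP) => [f_inj x y pxy fxy | f_inj x y].
  by apply/eqP/f_inj; rewrite pxy fxy !eqxx.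
by case/andP=> /eqP pxy /eqP fxy; apply/eqP/f_inj.
Qed.

Lemma not_fiberwise_inj (f : {ffun T -> 'F_3}) : f \notin fiberwise_inj_funs ->
  exists x y, [/\ x != y, pi x = pi y & f x = f y].
Proof.
rewrite inE => /forallPn[x /forallPn[y]]; rewrite negb_imply -andbA => /and3P[/eqP pxy /eqP fxy xy].
by exists x, y.
Qed.

(** Read through [h], such a function is an independent choice of one of the 3! permutations of
    GF(3) on each fiber. *)
Lemma card_fiberwise_inj_funs : #|fiberwise_inj_funs| = (6 ^ #|V|)%N.
Proof.
pose F (g : {ffun V -> {perm 'F_3}}) := [ffun x => g (pi x) (h x)].
have F_inj : injective F.
  move=> g g' /ffunP Egg'; apply/ffunP=> u; apply/permP=> a.
  by have := Egg' (pt u a); rewrite !ffunE pi_pt h_pt.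
have <- : #|{perm 'F_3}| = 6%N by rewrite card_Sn.
rewrite -card_ffun -cardsT -(card_imset _ F_inj); congr #|pred_of_set _|.
apply/setP=> f; apply/fiberwise_injP/imsetP => [f_inj|[g _ ->] x y pxy].
  have inj u : injective (fun a => f (pt u a)).
    by move=> a b /f_inj; rewrite !pi_pt => /(_ erefl)/pt_inj.
  exists [ffun u => perm (inj u)] => //; apply/ffunP=> x.
  by rewrite !ffunE permE ptK.
by rewrite !ffunE pxy => /perm_inj hxy; rewrite -[x]ptK -[y]ptK hxy pxy.
Qed.

Definition fun_system (f : T -> 'F_3) := local_system (fun=> f).

Lemma fun_system_dual f : dual_fun (fun_system f) f.
Proof. by apply/forall_inP=> A; rewrite inE => /and3P[]. Qed.

(** Orthogonality of [f] to the blocks gives inclusion of [B] in [fun_system f], and inclusion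
    between Steiner triple systems is equality. *)
Lemma fun_system_eq B (f : {ffun T -> 'F_3}) : steiner_triple_system B -> projects_to_lines B ->
  f \in fiberwise_inj_funs -> (B == fun_system f) = dual_fun B f.
Proof.
move=> sB pB /fiberwise_injP f_inj; apply/eqP/idP=> [->|dB]; first exact: fun_system_dual.
apply: sts_sub_eq => //; first exact: local_system_sts.
apply/subsetP=> A BA; rewrite inE (sts_card3 sB) // eqxx /=.
by rewrite (forall_inP pB _ BA) (forall_inP dB _ BA).
Qed.

End LocalSystem.
End ElementaryGroup.

(** * Affine functions on GF(3)^m *)

Lemma colF3_mul3 m (u : 'cV['F_3]_m) : u *+ 3 = 0.
Proof. by rewrite -scaler_nat (_ : 3%:R = 0 :> 'F_3) ?scale0r //; apply: val_inj. Qed.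

(** Comparing the relation for [u], [v] with that for [u + v], 0 shows that [g - g 0] is additive,
    and over GF(3) additive maps are linear. *)
Lemma mxF3_affine m (g : 'cV['F_3]_m -> 'F_3) :
    (forall u v, g u + g v + g (- (u + v)) = 0) ->
  exists (a : 'rV_m) c, forall u, g u = (a *m u) 0 0 + c.
Proof.
move=> g_sum; pose k u := g u - g 0.
have k0 : k 0 = 0 by rewrite /k subrr.
have kD : {morph k : u v / u + v}.
  move=> u v; have := g_sum (u + v) 0; rewrite addr0 -[RHS](g_sum u v) => /addIr E.
  by rewrite /k addrACA -E addrACA subrr addr0.
have kN u : k (- u) = - k u by apply/eqP; rewrite -addr_eq0 -kD addNr k0.
have kZ c u : k (c *: u) = k u * c.
  elim/F3P: c; rewrite ?scale0r ?mulr0 ?scale1r ?mulr1 //.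
  by rewrite scaleN1r mulrN1.
exists (\row_i k (delta_mx i 0)), (g 0) => u; rewrite -[LHS](subrK (g 0)) -/(k u).
congr (_ + _); rewrite {1}[u]matrix_sum_delta (big_morph k kD k0) mxE.
by apply: eq_bigr => i _; rewrite big_ord1 kZ mxE.
Qed.

(** * Counting the systems defined by a fiberwise injective function *)

Section Coordinates.
Variables (m : nat) (T : finType) (pi : T -> 'cV['F_3]_m) (h : T -> 'F_3).
Variable (pt : 'cV['F_3]_m -> 'F_3 -> T).
Hypotheses (pi_pt : forall u a, pi (pt u a) = u) (h_pt : forall u a, h (pt u a) = a).
Hypothesis (ptK : forall x, pt (pi x) (h x) = x).

Lemma dual_affine B (f : T -> 'F_3) : steiner_triple_system B -> projects_to_lines pi B ->
    dual_fun B f -> (exists x y, [/\ x != y, pi x = pi y & f x = f y]) ->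
  exists (a : 'rV_m) c, forall x, f x = (a *m pi x) 0 0 + c.
Proof.
move=> sB pB dB /(dual_fiber_const (@colF3_mul3 m) ptK sB pB dB) f_const.
have [g Dg /mxF3_affine[a [c Dac]]] := dual_fiber_factor pi_pt h_pt sB pB dB f_const.
by exists a, c => x; rewrite Dg Dac.
Qed.

Definition affine_shift (f : T -> 'F_3) (k : bool * 'rV['F_3]_m * 'F_3) : {ffun T -> 'F_3} :=
  [ffun x => (-1) ^+ k.1.1 * f x + ((k.1.2 *m pi x) 0 0 + k.2)].

Lemma affine_shift_inj f : fiberwise_inj pi f -> injective (affine_shift f).
Proof.
move=> f_inj [[s a] c] [[s' a'] c'] /ffunP E.
have {}E x : (-1) ^+ s * f x + ((a *m pi x) 0 0 + c) = (-1) ^+ s' * f x + ((a' *m pi x) 0 0 + c').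
  by have := E x; rewrite !ffunE.
(* Moving inside a fiber fixes the affine part and changes [f] by 1, which isolates the sign. With
   the signs equal, the affine parts are compared at 0 and at the unit vectors. *)
have next_pt x : exists2 y, pi y = pi x & f y - f x = 1.
  have [y py fy] := fiberwise_inj_surj pi_pt h_pt f_inj (pi x) (f x + 1).
  by exists y; rewrite ?fy ?py // addrAC subrr add0r.
have [y py fy] := next_pt (pt 0 0).
have Ess : s = s'.
  have sub (p q K L a0 b0 : 'F_3) : p * a0 + K = q * a0 + L -> p * b0 + K = q * b0 + L ->
      p * (a0 - b0) = q * (a0 - b0).
    by move=> Ea Eb; rewrite !mulrBr -[p * a0](addrK K) Ea -[p * b0](addrK K) Eb; ring.
  have Ey := E y; rewrite py in Ey.
  by apply: F3_sign_inj; have := sub _ _ _ _ _ _ Ey (E (pt 0 0)); rewrite fy !mulr1.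
have {}E (u : 'cV_m) : (a *m u) 0 0 + c = (a' *m u) 0 0 + c'.
  by have := E (pt u 0); rewrite pi_pt Ess => /addrI.
have Ec : c = c' by have := E 0; rewrite !mulmx0 !mxE !add0r.
rewrite Ess Ec; congr (_, _, _); apply/rowP=> j.
by have := E (delta_mx j 0); rewrite -!colE Ec => /addIr; rewrite !mxE.
Qed.

Lemma sum_affine (A : {set T}) (a : 'rV_m) c : #|A| = 3%N -> \sum_(x in A) pi x = 0 ->
  \sum_(x in A) ((a *m pi x) 0 0 + c) = 0.
Proof.
move=> A3 A0; rewrite big_split /= sumr_const A3.
rewrite -[c *+ 3]mulr_natl (_ : 3%:R = 0 :> 'F_3) ?mul0r ?addr0; last exact: val_inj.
by rewrite -summxE -mulmx_sumr A0 mulmx0 mxE.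
Qed.

(** Two functions define the same system exactly when they differ by a sign and an affine function:
    a suitable signed difference is a dual function with a coincidence on a fiber, hence affine. *)
Lemma affine_shift_imset (f : {ffun T -> 'F_3}) : f \in fiberwise_inj_funs pi ->
  [set f' in fiberwise_inj_funs pi | fun_system pi f' == fun_system pi f] = affine_shift f @: setT.
Proof.
move=> Ff; have f_inj := fiberwise_injP pi f Ff.
have sB : steiner_triple_system (fun_system pi f).
  exact: (local_system_sts (@colF3_mul3 m) pi_pt h_pt).
have pB : projects_to_lines pi (fun_system pi f) := local_system_projects _ _.
apply/setP=> f'; rewrite inE; apply/andP/imsetP => [[Ff' /eqP E]|[[[s a] c] _ ->]].
  have f'_inj := fiberwise_injP pi f' Ff'.
  have dB' : dual_fun (fun_system pi f) f' by rewrite -E fun_system_dual.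
  have [x [y [px py xy]]] := fiber_pair pi_pt h_pt 0.
  have nz f1 : fiberwise_inj pi f1 -> f1 x - f1 y != 0.
    by move=> f1_inj; rewrite subr_eq0; apply: contraNneq xy => /f1_inj->; rewrite ?px.
  have [t Dt] := F3_sign (nz _ f_inj); have [t' Dt'] := F3_sign (nz _ f'_inj).
  (* This sign makes [f' - (-1) ^+ s * f] take equal values at [x] and [y]. *)
  pose s := t (+) t'.
  have dB : dual_fun (fun_system pi f) (fun z => f' z - (-1) ^+ s * f z).
    apply/forall_inP=> A BA; rewrite sumrB -mulr_sumr.
    rewrite (eqP (forall_inP dB' _ BA)).
    by rewrite (eqP (forall_inP (fun_system_dual _ _) _ BA)) mulr0 subrr.
  have [|a [c Dac]] := dual_affine sB pB dB.
    exists x, y; split; rewrite ?px ?py //; apply/eqP; rewrite -subr_eq0.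
    rewrite (_ : _ - _ = (f' x - f' y) - (-1) ^+ s * (f x - f y)); last by ring.
    by rewrite Dt Dt' -signr_addb /s -addbA addbC addbK subrr.
  by exists (s, a, c) => //; apply/ffunP=> z; rewrite ffunE /= -Dac addrC subrK.
have Fs : affine_shift f (s, a, c) \in fiberwise_inj_funs pi.
  apply/fiberwise_injP=> x y pxy; rewrite !ffunE /= pxy => /addIr.
  by move/(mulrI (GRing.unitrX s (GRing.unitrN1 'F_3)))/f_inj->.
split=> //; rewrite eq_sym (fun_system_eq (@colF3_mul3 m) pi_pt h_pt) //.
apply/forall_inP=> A BA; under eq_bigr do rewrite ffunE /=.
rewrite big_split /= -mulr_sumr (eqP (forall_inP (fun_system_dual _ _) _ BA)) mulr0 add0r.
by rewrite sum_affine ?(sts_card3 sB) //; apply/eqP/(forall_inP pB).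
Qed.

Lemma card_fun_systems :
  (#|[set B | [&& steiner_triple_system B, projects_to_lines pi B
       & [exists f in fiberwise_inj_funs pi, dual_fun B f]]]| * (2 * 3 ^ m.+1) = 6 ^ (3 ^ m))%N.
Proof.
have -> : [set B | [&& steiner_triple_system B, projects_to_lines pi B
       & [exists f in fiberwise_inj_funs pi, dual_fun B f]]]
    = [set fun_system pi (f : {ffun T -> 'F_3}) | f in fiberwise_inj_funs pi].
  apply/setP=> B; rewrite inE; apply/and3P/imsetP => [[sB pB /exists_inP[f Ff]]|[f Ff ->]].
    by rewrite -(fun_system_eq (@colF3_mul3 m) pi_pt h_pt) // => /eqP; exists f.
  split; last by apply/exists_inP; exists f => //; apply: fun_system_dual.
    by apply: (local_system_sts (@colF3_mul3 m) pi_pt h_pt) => _; apply/fiberwise_injP.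
  exact: local_system_projects.
rewrite -[(3 ^ m)%N](_ : #|{: 'cV['F_3]_m}| = _); last by rewrite card_mx card_Fp // muln1.
rewrite -(card_fiberwise_inj_funs pi_pt h_pt ptK) -[RHS]sum1_card.
(* Functions are grouped by their system; each group is an injective image of the 2 * 3^m * 3 shift
   parameters. *)
rewrite (partition_big_imset (fun f : {ffun T -> 'F_3} => fun_system pi f)) /= -sum_nat_const.
apply: eq_bigr => _ /imsetP[f Ff ->].
rewrite sum1dep_card affine_shift_imset // card_imset; last exact/affine_shift_inj/fiberwise_injP.
by rewrite cardsT !card_prod card_bool card_mx card_Fp // mul1n expnSr mulnA.
Qed.
End Coordinates.

(** * The parity check matrix, its code and the rank condition *)

Section ParityCheck.
Variables (n v : nat) (M : 'M['F_3]_(n, v)) (i : 'I_n).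

Definition deleted_col (j : 'I_v) : 'cV['F_3]_n.-1 := col j (row' i M).

Lemma mem_parity_code (A : {set 'I_v}) : #|A| = 3%N ->
  (incidence_vector A \in ternary_code (parity_check M i)) =
  (\sum_(j in A) deleted_col j == 0).
Proof.
move=> A3; rewrite inE /parity_check mul_col_mx col_mx_eq0.
have sumA p (N : 'M['F_3]_(p, v)) : N *m (incidence_vector A)^T = \sum_(j in A) col j N.
  apply/matrixP=> k l; rewrite mxE summxE [RHS]big_mkcond /=; apply: eq_bigr => j _.
  by rewrite !mxE; case: ifP => _; rewrite ?mulr1 ?mulr0.
(* The all-one row imposes nothing on a triple, since 3 = 0 in GF(3). *)
rewrite !sumA (_ : \sum_(j in A) col j (const_mx 1) = 0) ?eqxx //.
apply/matrixP=> k l; rewrite summxE mxE.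
under eq_bigr do rewrite !mxE; rewrite sumr_const A3; exact: val_inj.
Qed.

Lemma row_parity_check (D : 'rV['F_3]_(1 + n.-1)) j :
  (D *m parity_check M i) 0 j = (rsubmx D *m deleted_col j) 0 0 + lsubmx D 0 0.
Proof.
rewrite /parity_check -{1}[D]hsubmxK mul_row_col mxE addrC; congr (_ + _).
  by rewrite !mxE; apply: eq_bigr => k _; rewrite !mxE.
by rewrite mxE big_ord1 !mxE mulr1.
Qed.

(** The all-one row contributes the constant and the other rows the linear part, so the row space is
    the space of affine functions of the projection. *)
Lemma sub_parity_check (f : 'rV['F_3]_v) :
  (f <= parity_check M i)%MS <->
  exists (a : 'rV_n.-1) c, forall j, f 0 j = (a *m deleted_col j) 0 0 + c.
Proof.
split=> [/submxP[D ->]|[a [c Df]]].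
  by exists (rsubmx D), (lsubmx D 0 0) => j; rewrite row_parity_check.
apply/submxP; exists (row_mx c%:M a); apply/rowP=> j.
by rewrite row_parity_check row_mxKl row_mxKr Df !mxE eqxx.
Qed.

Lemma mul_incidence_tr (B : {set {set 'I_v}}) (f : 'rV['F_3]_v) :
  (f *m (incidence_matrix B)^T == 0) = dual_fun B (fun j => f 0 j).
Proof.
have E k : (f *m (incidence_matrix B)^T) 0 k = \sum_(j in enum_val k) f 0 j.
  rewrite mxE [RHS]big_mkcond /=; apply: eq_bigr => j _.
  by rewrite !mxE; case: ifP => _; rewrite ?mulr1 ?mulr0.
apply/eqP/forall_inP=> [f0 A BA|dB].
  by have := E (enum_rank_in BA A); rewrite f0 mxE enum_rankK_in // => <-.
by apply/rowP=> k; rewrite E mxE; apply/eqP/dB/enum_valP.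
Qed.

Hypothesis M_bij : bijective (fun j => col j M).

(** The deleted entry of a column of [M] is the coordinate in the fiber and the remaining entries
    are the projection; together they recover the column, hence the point. *)
Lemma point_of_coords : exists pt : 'cV['F_3]_n.-1 -> 'F_3 -> 'I_v,
  [/\ forall u a, deleted_col (pt u a) = u, forall u a, M i (pt u a) = a
    & forall j, pt (deleted_col j) (M i j) = j].
Proof.
(* [full u a] reinserts [a] at row [i], the only row where [unlift] gives [None]. *)
have [g gK Kg] := M_bij; pose full (u : 'cV['F_3]_n.-1) a : 'cV['F_3]_n :=
  \col_k oapp (fun k' => u k' 0) a (unlift i k).
have M_g u k : M k (g u) = u k 0 by rewrite -[in RHS](Kg u) mxE.
exists (fun u a => g (full u a)); split=> [u a|u a|j].
- by apply/colP=> k; rewrite !mxE M_g mxE liftK.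
- by rewrite M_g mxE unlift_none.
rewrite -[RHS]gK; congr (g _); apply/colP=> k; rewrite !mxE.
by case: unliftP => [k' ->|->] //=; rewrite !mxE.
Qed.

Lemma row_free_parity_check : row_free (parity_check M i).
Proof.
have [pt [pt1 _ _]] := point_of_coords.
apply: inj_row_free => D D0.
have E (u : 'cV_n.-1) : (rsubmx D *m u) 0 0 + lsubmx D 0 0 = 0.
  by rewrite -(pt1 u 0) -row_parity_check D0 mxE.
have l0 : lsubmx D = 0.
  have := E 0; rewrite mulmx0 [X in X + _]mxE add0r => l00.
  by apply/rowP=> j; rewrite ord1 l00 mxE.
have r0 : rsubmx D = 0.
  apply/rowP=> j; have := E (delta_mx j 0).
  by rewrite -colE l0 mxE [X in _ + X]mxE addr0 => ->; rewrite mxE.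
by rewrite -[D]hsubmxK l0 r0 row_mx0.
Qed.

(** The dual code [K] contains the row space of the parity check matrix, which has dimension [n]. So
    the rank differs from [v - n] iff [K] contains a non-affine function, and a dual function is
    non-affine iff it is fiberwise injective. *)
Lemma rank3_deficient (B : {set {set 'I_v}}) : steiner_triple_system B ->
    projects_to_lines deleted_col B ->
  (rank3 B != (v - n)%N) = [exists f in fiberwise_inj_funs deleted_col, dual_fun B f].
Proof.
move=> sB pB; have [pt [pt1 pt2 pt3]] := point_of_coords.
have n_gt0 : (0 < n)%N by case: i => k; apply: leq_trans.
have rkH : \rank (parity_check M i) = n.
  by rewrite (eqP row_free_parity_check) add1n prednK.
pose K := kermx (incidence_matrix B)^T.
have dualP (f : 'rV_v) : (f <= K)%MS = dual_fun B (fun j => f 0 j).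
  by rewrite -mul_incidence_tr; apply/sub_kermxP/eqP.
have dual_parity (f : 'rV_v) : (f <= parity_check M i)%MS -> (f <= K)%MS.
  case/sub_parity_check=> a [c Df]; rewrite dualP; apply/forall_inP=> A BA.
  rewrite (eq_bigr _ (fun j _ => Df j)) sum_affine ?(sts_card3 sB) //.
  exact/eqP/(forall_inP pB).
have HK : (parity_check M i <= K)%MS.
  by apply/row_subP=> k; apply/dual_parity/row_sub.
have -> : (rank3 B != (v - n)%N) = ~~ (K <= parity_check M i)%MS.
  rewrite -(mxrank_leqif_sup HK) rkH mxrank_ker mxrank_tr /rank3.
  have := mxrankS HK; rewrite rkH mxrank_ker mxrank_tr.
  have := rank_leq_col (incidence_matrix B); lia.
apply/idP/exists_inP=> [/row_subPn[k not_f]|[f /fiberwise_injP f_inj dB]].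
  pose f := [ffun j => row k K 0 j].
  have dB : dual_fun B f.
    have := row_sub k K; rewrite dualP => /forall_inP dB; apply/forall_inP=> A /dB.
    by under [in X in _ -> X]eq_bigr do rewrite ffunE.
  exists f => //; apply: contraNT not_f => /not_fiberwise_inj eq_f.
  have [a [c Df]] := dual_affine pt1 pt2 pt3 sB pB dB eq_f.
  by apply/sub_parity_check; exists a, c => j; rewrite -Df ffunE.
(* An affine function of the projection cannot separate two points of a fiber. *)
have [x [y [px py xy]]] := fiber_pair pt1 pt2 0.
apply: contra xy => KH; apply/eqP/f_inj; first by rewrite px py.
have /sub_parity_check[a [c Df]] : (\row_j f j <= parity_check M i)%MS.
  apply: submx_trans KH; rewrite dualP; apply/forall_inP=> A BA.
  by under eq_bigr do rewrite mxE; apply: (forall_inP dB).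
by have [] := (Df x, Df y); rewrite !mxE px py => -> ->.
Qed.

End ParityCheck.

(** * The number of lines and the final count *)

Lemma card_affine_triples m :
  (2 * #|affine_triples 'cV['F_3]_m.+1| = 3 ^ m * (3 ^ m.+1 - 1))%N.
Proof.
(* The lines form a Steiner triple system on 3^(m+1) points, so three times their number is the
   number of pairs; a factor 3 is then cancelled. *)
have := sts_card (affine_triples_sts (@colF3_mul3 m.+1)).
rewrite card_mx card_Fp // muln1 bin2 -subn1 => E.
apply/eqP; rewrite -(eqn_pmul2l (isT : (0 < 3)%N)) mulnCA -E mulnA -expnS mul2n.
by rewrite even_halfK // oddM oddB ?expn_gt0 // oddX.
Qed.

Theorem theorem4p7 (n : nat) (hn : (2 <= n)%N)
    (M : 'M['F_3]_(n, 3 ^ n))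
    (hM : bijective (fun j : 'I_(3 ^ n) => col j M))
    (i : 'I_n) :
  (#|[set B : {set {set 'I_(3 ^ n)}} |
       [&& steiner_triple_system B,
           rank3 B == (3 ^ n - n)%N
         & [forall A in B,
              incidence_vector A \in ternary_code (parity_check M i)]]]|)%:R
  = 12%:R ^+ ((3 ^ (n - 2) * (3 ^ (n - 1) - 1)) %/ 2)
    - 6%:R ^+ (3 ^ (n - 1)) / (2%:R * 3%:R ^+ n) :> rat.
Proof.
have [pt [pt1 pt2 pt3]] := point_of_coords i hM.
pose P := projects_to_lines (deleted_col M i).
pose D (B : {set {set 'I_(3 ^ n)}}) :=
  [exists f in fiberwise_inj_funs (deleted_col M i), dual_fun B f].
set S := [set B | _].
(* The wanted systems are all those with blocks in the code, minus the rank-deficient ones. *)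
have defS : S = [set B | steiner_triple_system B && P B]
    :\: [set B | [&& steiner_triple_system B, P B & D B]].
  apply/setP=> B; rewrite !inE; case sB: (steiner_triple_system B) => //=.
  have -> : [forall A in B, incidence_vector A \in ternary_code (parity_check M i)] = P B.
    by apply: eq_forallb => A; case BA: (A \in B); rewrite //= mem_parity_code ?(sts_card3 sB).
  case pB: (P B); rewrite ?andbF //= !andbT.
  by rewrite -[LHS]negbK (rank3_deficient hM sB pB).
have subS : [set B | [&& steiner_triple_system B, P B & D B]]
    \subset [set B | steiner_triple_system B && P B].
  by apply/subsetP=> B; rewrite !inE => /and3P[-> ->].
have := card_fun_systems pt1 pt2 pt3; have := card_projecting_sts (@colF3_mul3 n.-1) pt1 pt2 pt3.
rewrite -/P => cardP cardD.
rewrite defS cardsDS // natrB ?subset_leq_card // cardP natrX; congr (_ ^+ _ - _).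
  case: n hn {M hM i pt pt1 pt2 pt3 P D S defS subS cardP cardD} => [|[|n]] // _.
  by rewrite !(subSS, subn0) -card_affine_triples mulKn.
rewrite subn1; have /(congr1 (fun k => k%:R : rat)) := cardD.
rewrite prednK ?(leq_trans _ hn) // natrM natrX => <-.
by rewrite natrM natrX mulfK // mulf_neq0 // expf_neq0.
Qed.
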